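(* Let $p_1,p_2$ be primes with $p_1\equiv 1 \pmod 4$ and $p_2\equiv 3\pmod 4$, let $m,n$ be positive integers, and let $N=p_1^mp_2^n$. Let $p$ be a prime such that $\mathrm{ord}_{p_1^m}(p)=\phi(p_1^m)$, $\mathrm{ord}_{p_2^n}(p)=\phi(p_2^n)$ and $f:=\mathrm{ord}_N(p)=\phi(N)/2$, where $\phi$ is Euler's totient function. Let $q=p^f$, let $\gamma$ be a primitive element of $\mathbb{F}_q$, and let $C_i=\gamma^i\langle\gamma^N\rangle$ for $0\le i\le N-1$ (indices read modulo $N$). Define $$D=\bigcup_{i=0}^{p_1^{m-1}-1}\ \bigcup_{j=0}^{p_2^{n-1}-1} C_{p_2^n i+p_1^m j}\subseteq \mathbb{F}_q .$$ Then the set $\{\psi(\gamma^a D)\,:\, a=0,1,\dots,q-2\}$ has at most five elements, where $\psi(\gamma^aD)=\sum_{x\in D}\psi(\gamma^a x)$.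
   Context: $\psi$ denotes the canonical additive character of $\mathbb{F}_q$, $\psi(x)=\exp\!\big(2\pi i\,\mathrm{Tr}_{q/p}(x)/p\big)$, where $\mathrm{Tr}_{q/p}$ is the absolute trace from $\mathbb{F}_q$ to $\mathbb{F}_p$. $\mathrm{ord}_M(p)$ is the multiplicative order of $p$ modulo $M$. The sets $C_i$ are the cyclotomic classes of order $N$ of $\mathbb{F}_q$. *)

(* Defs.v *)
From HB Require Import structures.
From mathcomp Require Import all_boot all_order all_algebra all_field.
Set Implicit Arguments. Unset Strict Implicit. Unset Printing Implicit Defensive.
Import GRing.Theory Num.Theory.

Definition is_ordmod (M a k : nat) : Prop :=
  [/\ 0 < k, a ^ k = 1 %[mod M] &
      forall j, 0 < j -> a ^ j = 1 %[mod M] -> k <= j]%N.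

Local Open Scope ring_scope.

Definition abs_trace (F : finFieldType) (p f : nat) (x : F) : F :=
  \sum_(i < f) x ^+ (p ^ i).

Definition prime_field_rep (F : finFieldType) (p : nat) (y : F) : nat :=
  if [pick k : 'I_p | (k%:R : F) == y] is Some k then nat_of_ord k else 0%N.

(* exp(2 pi i / p) in algC: p.-root (-1) = exp(i pi / p) *)
Definition zeta_p (p : nat) : algC := (p.-root (-1)) ^+ 2.

Definition psi (F : finFieldType) (p f : nat) (x : F) : algC :=
  zeta_p p ^+ prime_field_rep p (abs_trace p f x).

Definition cyc_class (F : finFieldType) (gamma : F) (N i : nat) : {set F} :=
  [set x | [exists k : 'I_#|F|, x == gamma ^+ (i + N * k)]].

Definition Dset (F : finFieldType) (gamma : F) (p1 p2 m n : nat) : {set F} :=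
  let N := (p1 ^ m * p2 ^ n)%N in
  \bigcup_(i < p1 ^ m.-1) \bigcup_(j < p2 ^ n.-1)
     cyc_class gamma N ((p2 ^ n * i + p1 ^ m * j) %% N).

Definition psi_shift (F : finFieldType) (p f : nat) (gamma : F) (D : {set F}) (a : nat)
  : algC := \sum_(x in D) psi p f (gamma ^+ a * x).

(* Main.v *)
Require Import Defs.
From HB Require Import structures.
From mathcomp Require Import all_boot all_order all_algebra all_field.
Set Implicit Arguments. Unset Strict Implicit. Unset Printing Implicit Defensive.
Import GRing.Theory Num.Theory.
Local Open Scope ring_scope.

(** No Gauss sums are needed. Put P = p1^m, Q = p2^n, P' = p1^(m-1) and
    Q' = p2^(n-1). Frobenius invariance of psi makes the Gaussian periods
    eta_i = psi(C_i) depend only on the orbit of i under multiplication by p in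
    Z/N = Z/P x Z/Q. As <p> surjects onto the units of both factors and has
    index 2, it contains (1, p^e) and (p^e, 1) for every even e. If Q' does not
    divide y and y' = y mod Q', then y' = p^e y mod Q with p^e = 1 mod p2, which
    forces e to be even; so eta(x, y) = eta(x, y'), and likewise for x.
    Now psi(gamma^a D) sums eta over a box in which each residue modulo P'
    (resp. modulo Q') occurs exactly once in the x (resp. y) direction, so it
    depends only on the unique (x0, y0) of the box with P' | x0 and Q' | y0, and
    on this pair only up to multiplication by p; there are five such orbits. *)

(** * Congruences and multiplicative orders of natural numbers *)

Section OrderModulo.
Local Open Scope nat_scope.

Lemma expn_mod1 M a k d : a ^ k = 1 %[mod M] -> a ^ (d * k) = 1 %[mod M].
Proof. by move=> ak; rewrite mulnC expnM -modnXm ak modnXm exp1n. Qed.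

Lemma eqmodM M a b c d :
  a = b %[mod M] -> c = d %[mod M] -> a * c = b * d %[mod M].
Proof. by move=> ab cd; rewrite -modnMm ab cd modnMm. Qed.

Lemma eqmodD M a b c d :
  a = b %[mod M] -> c = d %[mod M] -> a + c = b + d %[mod M].
Proof. by move=> ab cd; rewrite -modnDm ab cd modnDm. Qed.

Lemma eqmod_dvd d M a b : d %| M -> a = b %[mod M] -> a = b %[mod d].
Proof. by move=> dM ab; rewrite -(modn_dvdm a dM) ab modn_dvdm. Qed.

Lemma modn_inv c M : 0 < M -> coprime c M -> exists d, d * c = 1 %[mod M].
Proof.
move=> M_gt0 /eqP cM; case: (posnP c) cM => [->|c_gt0 cM].
  by rewrite gcd0n => ->; exists 0; rewrite !modn1.
case: (egcdnP M c_gt0) => d d' e _; exists d; rewrite e cM.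
by rewrite -modnDml modnMl.
Qed.

Lemma eqmod_cancel c M x y :
  0 < M -> coprime c M -> c * x = c * y %[mod M] -> x = y %[mod M].
Proof.
move=> M_gt0 /(modn_inv M_gt0)[d dc] cxy.
rewrite -[x]mul1n -[y]mul1n.
rewrite (eqmodM (esym dc) (erefl _)) [RHS](eqmodM (esym dc) (erefl _)).
by rewrite -!mulnA; apply: eqmodM.
Qed.

Lemma ordmod_dvdn M a k d :
  is_ordmod M a k -> a ^ d = 1 %[mod M] -> k %| d.
Proof.
move=> [k_gt0 ak kmin] ad; rewrite /dvdn; case: posnP => // r_gt0.
suff /(kmin _ r_gt0) : a ^ (d %% k) = 1 %[mod M] by rewrite leqNgt ltn_pmod.
rewrite -ad {2}(divn_eq d k) expnD -[LHS](congr1 (modn^~ M) (mul1n _)).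
by apply: eqmodM => //; rewrite expn_mod1.
Qed.

Lemma ordmod_coprime M a k : is_ordmod M a k -> coprime a M.
Proof.
move=> [k_gt0 ak _]; rewrite -(coprime_pexpl _ _ k_gt0).
by rewrite -coprime_modl ak coprime_modl coprime1n.
Qed.

Lemma ordmod_expn_inj M a k i j :
  is_ordmod M a k -> a ^ i = a ^ j %[mod M] -> i = j %[mod k].
Proof.
move=> aM; wlog le_ij : i j / i <= j.
  by move=> W *; case: (leqP i j) => [|/ltnW] /W E; [|apply/esym]; apply: E.
move=> aij; have [k_gt0 ak _] := aM.
apply/esym/eqP; rewrite eqn_mod_dvd //.
(* The extra [k * i] avoids inverting [a]: [a ^ (k * i - i)] serves as the inverse of [a ^ i]. *)
have : k %| k * i + (j - i).
  apply: (ordmod_dvdn aM).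
  have le_i : i <= k * i by rewrite leq_pmull.
  rewrite addnBA // -addnBAC //.
  rewrite expnD (eqmodM (erefl _) (esym aij)) -expnD subnK //.
  by rewrite mulnC expn_mod1.
by rewrite dvdn_addr ?dvdn_mulr.
Qed.

(** Counting: the first [totient M] powers of [a] are distinct modulo [M] and coprime to it, so they
    exhaust the units. *)
Lemma ordmod_totient_surj M a u :
  0 < M -> is_ordmod M a (totient M) -> coprime u M ->
  exists k, u = a ^ k %[mod M].
Proof.
move=> M_gt0 aM co_u.
pose s := [seq a ^ i %% M | i <- iota 0 (totient M)].
pose s' := [seq d <- iota 0 M | coprime M d].
have uniq_s : uniq s.
  rewrite map_inj_in_uniq ?iota_uniq // => i j.
  rewrite !mem_iota !add0n /= => i_lt j_lt /(ordmod_expn_inj aM).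
  by rewrite !modn_small.
have sub_s : {subset s <= s'}.
  move=> _ /mapP[i _ ->]; rewrite mem_filter mem_iota /= ltn_mod M_gt0 andbT.
  by rewrite coprime_modr coprimeXr // coprime_sym (ordmod_coprime aM).
have size_s : size s' <= size s.
  rewrite size_map size_iota totient_count_coprime size_filter -sum1_count.
  by rewrite big_mkcond /= /index_iota subn0 leq_sum // => i _; case: ifP.
have [] := uniq_min_size uniq_s sub_s size_s; move=> _ /(_ (u %% M)).
rewrite [in RHS]mem_filter mem_iota /= ltn_mod M_gt0 coprime_modr coprime_sym.
by rewrite co_u => /mapP[k _ ->]; exists k.
Qed.

(** Each [r]-th power gains a factor [r]: in [b ^ r - 1 = (b - 1) * \sum_(i < r) b ^ i] the sum has
    [r] terms, all 1 modulo [r]. *)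
Lemma expn_expn_mod1 r n a :
  0 < r -> 0 < a -> a = 1 %[mod r] -> a ^ (r ^ n) = 1 %[mod r ^ n.+1].
Proof.
move=> r_gt0 a_gt0 a1; elim: n => [|n IHn]; first by rewrite expn0 !expn1.
have b_gt0 : 0 < a ^ (r ^ n) by rewrite expn_gt0 a_gt0.
rewrite [r ^ n.+1]expnSr expnM; move: (a ^ _) b_gt0 IHn => b b_gt0 b1.
have b_eq1 : b = 1 %[mod r] by apply: eqmod_dvd b1; rewrite expnS dvdn_mulr.
apply/eqP; rewrite eqn_mod_dvd ?expn_gt0 ?b_gt0 // subn1 predn_exp expnSr.
apply: dvdn_mul; first by rewrite -subn1 -eqn_mod_dvd //; apply/eqP.
suff sum_r : \sum_(i < r) b ^ i = r %[mod r] by rewrite /dvdn sum_r modnn.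
transitivity ((\sum_(i < r) 1) %% r); last by rewrite sum1_card card_ord.
apply: (big_ind2 (fun x y => x = y %[mod r])) => // [x y z t|i _].
  exact: eqmodD.
by rewrite -modnXm b_eq1 modnXm exp1n.
Qed.

End OrderModulo.

(** * Sums of functions that are periodic away from the multiples of [M] *)

Section LocallyConstant.
Variables (V : zmodType) (M : nat) (g : nat -> V).
Hypothesis M_gt0 : (0 < M)%N.
Hypothesis g_loc :
  forall y y', (y = y' %[mod M])%N -> ~~ (M %| y)%N -> g y = g y'.

(** The map [i |-> a + c * i] permutes the residues modulo [M], and [g] sees only the residue,
    except at [i0], where the argument is a multiple of [M] and must be kept as it is. *)
Lemma sum_progression c a i0 :
  coprime c M -> (i0 < M)%N -> (M %| a + c * i0)%N ->
  \sum_(i < M) g (a + c * i)%N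
    = \sum_(z < M | z != 0%N :> nat) g z + g (a + c * i0)%N.
Proof.
move=> co_c i0_lt Mi0.
pose h (i : 'I_M) : 'I_M := Ordinal (ltn_pmod (a + c * i) M_gt0).
have h_inj : injective h.
  move=> i j /(congr1 val)/= /eqP; rewrite eqn_modDl => /eqP cij.
  apply/val_inj; rewrite /= -(modn_small (ltn_ord i)) -(modn_small (ltn_ord j)).
  exact: eqmod_cancel co_c cij.
have h0 i : (h i != 0%N :> nat) = (i != Ordinal i0_lt).
  have hi0 : h (Ordinal i0_lt) = 0%N :> nat by apply/eqP.
  congr (~~ _); apply/eqP/eqP => [hi|-> //].
  by apply/h_inj/val_inj; exact: etrans hi (esym hi0).
rewrite (bigD1 (Ordinal i0_lt)) //= addrC; congr (_ + _).
rewrite [RHS](reindex_inj h_inj) /=; apply: eq_big => i; first by rewrite -h0.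
by rewrite -h0 => hi_neq0; apply: g_loc; rewrite ?modn_mod.
Qed.

(** Progression from 0: the exceptional term is [g 0] on both sides and cancels. *)
Lemma sum_residues_mul c : coprime c M ->
  \sum_(z < M | z != 0%N :> nat) g (c * z)%N = \sum_(z < M | z != 0%N :> nat) g z.
Proof.
move=> co_c; have M0 : (M %| 0 + c * 0)%N by rewrite muln0.
have := sum_progression co_c M_gt0 M0.
rewrite (bigD1 (Ordinal M_gt0)) //= addrC => /addIr <-.
by apply: eq_bigl.
Qed.

End LocallyConstant.

(** * Powers of a generator [p] of the units modulo [r ^ n] *)

Section PrimePowerModulus.
Variables (p r n : nat).
Hypotheses (r_pr : prime r) (r_odd : odd r) (n_gt0 : (0 < n)%N).
Hypothesis p_ord : is_ordmod (r ^ n) p (totient (r ^ n)).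

Let rn_gt0 : (0 < r ^ n)%N. Proof. by rewrite expn_gt0 prime_gt0. Qed.

Lemma totient_even : ~~ odd (totient (r ^ n)).
Proof.
rewrite totient_pfactor // oddM negb_and -subn1 oddB ?prime_gt0 //.
by rewrite r_odd.
Qed.

Lemma generator_coprime : coprime p r.
Proof. by have := ordmod_coprime p_ord; rewrite coprime_pexpr. Qed.

(** Raising to the power [r ^ n.-1] gives 1 modulo [r ^ n], so the even number [totient (r ^ n)]
    divides [e * r ^ n.-1], whose second factor is odd. *)
Lemma generator_mod1_even e : (p ^ e = 1 %[mod r])%N -> ~~ odd e.
Proof.
move=> pe; have p_gt0 : (0 < p)%N.
  case: posnP generator_coprime => // ->; rewrite /coprime gcd0n => /eqP r1.
  by move: r_pr; rewrite r1.
have pe_gt0 : (0 < p ^ e)%N by rewrite expn_gt0 p_gt0.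
have := expn_expn_mod1 n.-1 (prime_gt0 r_pr) pe_gt0 pe.
rewrite prednK // -expnM => /(ordmod_dvdn p_ord)/dvdnP[k ek].
have /(congr1 odd) := ek.
by rewrite !oddM oddX r_odd orbT andbT (negPf totient_even) andbF => ->.
Qed.

(** Write [y = u * r ^ n.-1]: either [r] divides [u], or [u] is a unit and hence a power of [p]. *)
Lemma dvdn_top_power y : (r ^ n.-1 %| y)%N ->
  (y = 0 %[mod r ^ n])%N \/ exists k, (y = p ^ k * r ^ n.-1 %[mod r ^ n])%N.
Proof.
case/dvdnP=> u ->; case: (boolP (r %| u)%N) => [/dvdnP[v ->]|].
  left; apply/eqP; rewrite mod0n -/(dvdn _ _) -mulnA -expnS prednK //.
  exact: dvdn_mull.
rewrite -prime_coprime // coprime_sym => co_u; right.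
have [|k uk] := ordmod_totient_surj (u := u) rn_gt0 p_ord.
  by rewrite coprime_pexpr.
by exists k; apply: eqmodM.
Qed.

(** Both arguments are divisible by the same [r ^ t] with [t < n.-1], and their cofactors agree
    modulo [r]; the quotient of the cofactors is a power of [p] that is 1 modulo [r], so its
    exponent is even. *)
Lemma even_locally_constant (V : eqType) (g : nat -> V) y y' :
  (forall z z', (z = z' %[mod r ^ n])%N -> g z = g z') ->
  (forall e z, ~~ odd e -> g (p ^ e * z)%N = g z) ->
  (y = y' %[mod r ^ n.-1])%N -> ~~ (r ^ n.-1 %| y)%N -> g y = g y'.
Proof.
move=> g_mod g_even yy' Ny.
have y_gt0 : (0 < y)%N by case: posnP Ny => // ->; rewrite dvdn0.
have [u co_u def_y] := pfactor_coprime r_pr y_gt0.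
set t := logn r y in def_y.
have t_lt : (t < n.-1)%N by rewrite ltnNge -pfactor_dvdn.
have rt_gt0 : (0 < r ^ t)%N by rewrite expn_gt0 prime_gt0.
have [u' def_y'] : exists u', y' = (u' * r ^ t)%N.
  apply/dvdnP; rewrite /dvdn -(eqmod_dvd (dvdn_exp2l r (ltnW t_lt)) yy').
  by rewrite -/(dvdn _ _) def_y dvdn_mull.
have uu' : (u = u' %[mod r])%N.
  have /eqP := eqmod_dvd (dvdn_exp2l r t_lt) yy'.
  rewrite def_y def_y' expnS -!muln_modl eqn_pmul2r //; exact/eqP.
have co_u' : coprime u' (r ^ n).
  by rewrite coprime_pexpr // -coprime_modl -uu' coprime_modl coprime_sym.
have co_un : coprime u (r ^ n) by rewrite coprime_pexpr // coprime_sym.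
have [i ui] := ordmod_totient_surj rn_gt0 p_ord co_un.
have [d du] := modn_inv rn_gt0 co_un.
(* As [d] inverts [u], [e] is the discrete logarithm of [u' / u]. *)
have [e de] : exists e, (u' * d = p ^ e %[mod r ^ n])%N.
  apply: (ordmod_totient_surj rn_gt0 p_ord); rewrite coprimeMl co_u' /=.
  move: (coprime1n (r ^ n)); rewrite -coprime_modl -du coprime_modl.
  by rewrite coprimeMl => /andP[].
have u'E : (u' = p ^ e * u %[mod r ^ n])%N.
  rewrite -[LHS](congr1 (modn^~ _) (muln1 u')) (eqmodM (erefl _) (esym du)) mulnA.
  exact: eqmodM.
have r_dvd : (r %| r ^ n)%N by rewrite dvdn_exp.
have e_even : ~~ odd e.
  apply: generator_mod1_even; rewrite -(eqmod_dvd r_dvd de).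
  by rewrite (eqmodM (esym uu') (erefl _)) mulnC (eqmod_dvd r_dvd du).
rewrite -(g_even _ y e_even); apply: g_mod.
by rewrite def_y def_y' mulnA; apply: eqmodM.
Qed.

End PrimePowerModulus.

(** * Functions on [Z/P x Z/Q], given on representatives, and multiplication by [p] *)

Definition bimodular (V : Type) (P Q : nat) (G : nat -> nat -> V) :=
  forall x x' y y',
    (x = x' %[mod P])%N -> (y = y' %[mod Q])%N -> G x y = G x' y'.

Definition mul_invariant (V : Type) (p : nat) (G : nat -> nat -> V) :=
  forall x y, G (p * x)%N (p * y)%N = G x y.

Section TwoModuli.
Variables (V : Type) (p P Q k l : nat) (G : nat -> nat -> V).
Hypotheses (k_gt0 : (0 < k)%N) (pk : (p ^ k = 1 %[mod P])%N).
Hypotheses (pl : (p ^ l = 1 %[mod Q])%N) (gcd_kl : gcdn k l = 2).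
Hypotheses (G_mod : bimodular P Q G) (G_mul : mul_invariant p G).

Lemma mul_invariant_expn e x y : G (p ^ e * x)%N (p ^ e * y)%N = G x y.
Proof.
by elim: e => [|e IHe]; rewrite ?expn0 ?mul1n // expnS -!mulnA G_mul.
Qed.

(* Bezout for [k] and [l] gives an exponent divisible by [k] and congruent to
   [e] modulo [l]: multiplying by that power of [p] moves [y] only. *)
Lemma mul_invariant_even_r e x y : ~~ odd e -> G x (p ^ e * y)%N = G x y.
Proof.
move=> e_even; case: (egcdnP l k_gt0) => a b ab _.
have e2 : (e = e./2 * 2)%N by rewrite -[LHS]odd_double_half (negPf e_even) muln2.
have ka : (e./2 * a * k = e./2 * b * l + e)%N.
  by rewrite {3}e2 -!mulnA ab gcd_kl mulnDr.
rewrite -(mul_invariant_expn (e./2 * a * k) x y); apply: G_mod.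
  rewrite -[LHS](congr1 (modn^~ P) (mul1n x)).
  by apply: eqmodM => //; rewrite expn_mod1.
rewrite ka -[(p ^ e)%N]mul1n expnD; apply: eqmodM => //; apply: eqmodM => //.
by rewrite expn_mod1.
Qed.

End TwoModuli.

Lemma bimodular_swap (V : Type) P Q (G : nat -> nat -> V) :
  bimodular P Q G -> bimodular Q P (fun y x => G x y).
Proof. by move=> G_mod x x' y y' *; apply: G_mod. Qed.

Lemma mul_invariant_swap (V : Type) p (G : nat -> nat -> V) :
  mul_invariant p G -> mul_invariant p (fun y x => G x y).
Proof. by move=> G_mul x y; apply: G_mul. Qed.

(** * Sums over a box of residues *)

Lemma progression_hits a c M :
  (0 < M)%N -> coprime c M -> exists2 i, (i < M)%N & (M %| a + c * i)%N.
Proof.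
(* Here [s] represents [-a] and [d] inverts [c], so [d * s] solves [a + c * i = 0] modulo [M]. *)
move=> M_gt0 /(modn_inv M_gt0)[d dc]; pose s := (M - a %% M)%N.
exists (d * s %% M)%N; first by rewrite ltn_mod.
have cds : (c * (d * s %% M) = s %[mod M])%N.
  by rewrite modnMmr mulnA (mulnC c) -modnMml dc modnMml mul1n.
rewrite /dvdn (eqmodD (esym (modn_mod a M)) cds) subnKC ?modnn //.
by rewrite ltnW // ltn_mod.
Qed.

(** Normal form of a sum over a box: nonzero residues stand for themselves, while the exceptional
    coordinates [x] and [y] keep their actual values. *)
Definition box_sum (V : zmodType) (M M' : nat) (G : nat -> nat -> V) (x y : nat) :=
  \sum_(w < M | w != 0%N :> nat) (\sum_(z < M' | z != 0%N :> nat) G w z + G w y)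
  + (\sum_(z < M' | z != 0%N :> nat) G x z + G x y).

Section BoxSum.
Variables (V : zmodType) (p p1 p2 m n : nat) (G : nat -> nat -> V).
Hypotheses (p1_pr : prime p1) (p1_odd : odd p1) (m_gt0 : (0 < m)%N).
Hypotheses (p2_pr : prime p2) (p2_odd : odd p2) (n_gt0 : (0 < n)%N).
Hypothesis p_ord1 : is_ordmod (p1 ^ m) p (totient (p1 ^ m)).
Hypothesis p_ord2 : is_ordmod (p2 ^ n) p (totient (p2 ^ n)).
Hypothesis gcd2 : gcdn (totient (p1 ^ m)) (totient (p2 ^ n)) = 2.
Hypothesis G_mod : bimodular (p1 ^ m) (p2 ^ n) G.
Hypothesis G_mul : mul_invariant p G.

Local Notation P := (p1 ^ m)%N.
Local Notation Q := (p2 ^ n)%N.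
Local Notation P' := (p1 ^ m.-1)%N.
Local Notation Q' := (p2 ^ n.-1)%N.

(** Kept general in [H] so as to apply both to [G] and to its box sum. *)
Lemma even_invariant_r (W : Type) (H : nat -> nat -> W) :
  bimodular P Q H -> mul_invariant p H ->
  forall e x y, ~~ odd e -> H x (p ^ e * y)%N = H x y.
Proof.
case: p_ord1 p_ord2 => k_gt0 pk _ [l_gt0 pl _].
exact: mul_invariant_even_r k_gt0 pk pl gcd2.
Qed.

Lemma even_invariant_l (W : Type) (H : nat -> nat -> W) :
  bimodular P Q H -> mul_invariant p H ->
  forall e x y, ~~ odd e -> H (p ^ e * x)%N y = H x y.
Proof.
case: p_ord1 p_ord2 => k_gt0 pk _ [l_gt0 pl _] H_mod H_mul e x y.
have gcd2' : gcdn (totient Q) (totient P) = 2 by rewrite gcdnC.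
exact: mul_invariant_even_r l_gt0 pl pk gcd2' (bimodular_swap H_mod)
  (mul_invariant_swap H_mul) e y x.
Qed.

Lemma loc_r x y y' :
  (y = y' %[mod Q'])%N -> ~~ (Q' %| y)%N -> G x y = G x y'.
Proof.
apply: (even_locally_constant p2_pr p2_odd n_gt0 p_ord2) => [z z' zz'|e z].
  exact: G_mod.
exact: even_invariant_r.
Qed.

Lemma loc_l y x x' :
  (x = x' %[mod P'])%N -> ~~ (P' %| x)%N -> G x y = G x' y.
Proof.
apply: (even_locally_constant p1_pr p1_odd m_gt0 p_ord1 (g := G^~ y)).
  by move=> z z' zz'; apply: G_mod.
by move=> e z; apply: even_invariant_l.
Qed.

Let P'_gt0 : (0 < P')%N. Proof. by rewrite expn_gt0 prime_gt0. Qed.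
Let Q'_gt0 : (0 < Q')%N. Proof. by rewrite expn_gt0 prime_gt0. Qed.

Lemma sum_box a b c d :
  coprime c P' -> coprime d Q' ->
  exists x y, [/\ (P' %| x)%N, (Q' %| y)%N &
    \sum_(i < P') \sum_(j < Q') G (a + c * i)%N (b + d * j)%N
      = box_sum P' Q' G x y].
Proof.
move=> co_c co_d.
have [i0 i0_lt x_dvd] := progression_hits a P'_gt0 co_c.
have [j0 j0_lt y_dvd] := progression_hits b Q'_gt0 co_d.
exists (a + c * i0)%N, (b + d * j0)%N; split=> //.
under eq_bigr do rewrite (sum_progression Q'_gt0 (loc_r _) co_d j0_lt y_dvd).
(* The exceptional [b + d * j0] is the same in every row, so the row sum [h] inherits local
   constancy in [x] term by term. *)
pose h x := \sum_(z < Q' | z != 0%N :> nat) G x z + G x (b + d * j0)%N.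
rewrite (sum_progression (g := h) P'_gt0 _ co_c i0_lt x_dvd) // => x x' xx' Nx.
congr (_ + _); last exact: loc_l.
by apply: eq_bigr => z _; apply: loc_l.
Qed.

Lemma box_sum_mod : bimodular P Q (box_sum P' Q' G).
Proof.
move=> x x' y y' xx' yy'; rewrite /box_sum; congr (_ + (_ + _)).
- by apply: eq_bigr => w _; congr (_ + _); apply: G_mod.
- by apply: eq_bigr => z _; apply: G_mod.
- exact: G_mod.
Qed.

(** Multiplication by [p] permutes the nonzero residues modulo [P'] and [Q']; after reindexing, the
    invariance of [G] applies termwise. *)
Lemma box_sum_mul : mul_invariant p (box_sum P' Q' G).
Proof.
have co_p1 : coprime p P' by rewrite coprimeXr ?(generator_coprime m_gt0 p_ord1).
have co_p2 : coprime p Q' by rewrite coprimeXr ?(generator_coprime n_gt0 p_ord2).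
move=> x y; rewrite /box_sum !big_split /=.
rewrite -(sum_residues_mul P'_gt0 (loc_l (p * y)) co_p1).
rewrite -(sum_residues_mul Q'_gt0 (loc_r (p * x)) co_p2) G_mul.
by congr (_ + _ + (_ + _)); apply: eq_bigr => w _; rewrite G_mul.
Qed.

(* Up to multiplication by powers of [p], a pair of multiples of [P'] and [Q']
   has one of five values: a pair of nonzero multiples is only determined up to
   the parity of the difference of the two discrete logarithms. *)
Lemma five_orbits (W : eqType) (T : nat -> nat -> W) x y :
  bimodular P Q T -> mul_invariant p T -> (P' %| x)%N -> (Q' %| y)%N ->
  T x y \in [:: T 0 0; T P' 0; T 0 Q'; T P' Q'; T P' (p * Q')]%N.
Proof.
move=> T_mod T_mul x_dvd y_dvd; have T_exp := mul_invariant_expn T_mul.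
case: (dvdn_top_power p1_pr m_gt0 p_ord1 x_dvd) => [x0|[k xk]];
case: (dvdn_top_power p2_pr n_gt0 p_ord2 y_dvd) => [y0|[l yl]].
- by rewrite (T_mod _ _ _ _ x0 y0) !inE eqxx.
- by rewrite (T_mod _ _ _ _ x0 yl) -(muln0 (p ^ l)%N) T_exp muln0 !inE eqxx ?orbT.
- by rewrite (T_mod _ _ _ _ xk y0) -(muln0 (p ^ k)%N) T_exp muln0 !inE eqxx ?orbT.
have [l_gt0 pl _] := p_ord2.
(* Adding a multiple of [totient Q] keeps [p ^ l] modulo [Q] and makes the subtraction of [k]
   exact. *)
have kl : (k <= k * totient Q + l)%N
  by rewrite (leq_trans (leq_pmulr k l_gt0)) ?leq_addr.
have yl' : (y = p ^ k * (p ^ (k * totient Q + l - k) * Q') %[mod Q])%N.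
  rewrite yl mulnA -expnD subnKC // -[(p ^ l)%N]mul1n expnD.
  by apply: eqmodM => //; apply: eqmodM => //; rewrite expn_mod1.
rewrite (T_mod _ _ _ _ xk yl') T_exp; move: (_ - k)%N => e.
rewrite -(odd_double_half e) addnC expnD -mulnA.
rewrite (even_invariant_r T_mod T_mul) ?odd_double //.
by case: (odd e); rewrite ?expn1 ?mul1n !inE eqxx ?orbT.
Qed.

End BoxSum.

(** * Gaussian periods and the Frobenius map *)

Section CyclotomicPeriods.
Variables (F : finFieldType) (gamma : F) (N p f : nat).
Hypothesis gamma_prim : (#|F|.-1).-primitive_root gamma.
Hypothesis N_dvd : (N %| #|F|.-1)%N.
Hypothesis cardF : #|F| = (p ^ f)%N.

Let q1_gt0 : (0 < #|F|.-1)%N. Proof. exact: prim_order_gt0 gamma_prim. Qed.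
Let N_gt0 : (0 < N)%N. Proof. exact: dvdn_gt0 N_dvd. Qed.
Let f_gt0 : (0 < f)%N.
Proof. by move: q1_gt0; rewrite cardF; case: (f). Qed.

Lemma cyc_classP i x :
  reflect (exists2 e, (e = i %[mod N])%N & x = gamma ^+ e)
          (x \in cyc_class gamma N i).
Proof.
rewrite inE; apply: (iffP existsP) => [[k /eqP->]|[e ei ->]].
  by exists (i + N * k)%N => //; rewrite addnC mulnC modnMDl.
(* Multiples of [#|F|.-1] do not change the power of [gamma]: one is added to exceed [i], then [k]
   is reduced to fit in ['I_#|F|]. *)
have i_le : (i <= e + i * #|F|.-1)%N.
  by rewrite (leq_trans (leq_pmulr i q1_gt0)) ?leq_addl.
have /dvdnP[k ek] : (N %| e + i * #|F|.-1 - i)%N.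
  rewrite -eqn_mod_dvd // addnC -modnDml.
  by have /eqP -> : (N %| i * #|F|.-1)%N; [rewrite dvdn_mull | rewrite add0n ei].
have k_lt : (k %% #|F|.-1 < #|F|)%N.
  by rewrite (leq_trans (ltn_pmod _ q1_gt0)) ?leq_pred.
exists (Ordinal k_lt); rewrite (eq_prim_root_expr gamma_prim) /=.
by rewrite -modnDmr modnMmr modnDmr mulnC -ek subnKC // addnC modnMDl.
Qed.

Lemma eq_cyc_class i j :
  (i = j %[mod N])%N -> cyc_class gamma N i = cyc_class gamma N j.
Proof.
by move=> ij; apply/setP=> x; apply/cyc_classP/cyc_classP => -[e ei ->];
   exists e => //; rewrite ei.
Qed.

Lemma disjoint_cyc_class i j :
  (i <> j %[mod N])%N -> [disjoint cyc_class gamma N i & cyc_class gamma N j].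
Proof.
move=> ij; apply/pred0P => x /=; apply/andP => -[/cyc_classP[e ei ->]].
case/cyc_classP=> e' ej /eqP; rewrite (eq_prim_root_expr gamma_prim) => /eqP ee'.
by apply: ij; rewrite -ei -ej (eqmod_dvd N_dvd ee').
Qed.

Definition period i := \sum_(x in cyc_class gamma N i) psi p f x.

Lemma eq_period i j : (i = j %[mod N])%N -> period i = period j.
Proof. by rewrite /period => /eq_cyc_class->. Qed.

Lemma sum_cyc_class_shift a i :
  \sum_(x in cyc_class gamma N i) psi p f (gamma ^+ a * x) = period (a + i).
Proof.
have ga_neq0 : gamma ^+ a != 0.
  by rewrite expf_neq0 // (prim_root_eq0 gamma_prim) -lt0n.
rewrite /period [RHS](reindex_inj (mulfI ga_neq0)) /=; apply: eq_bigl => x.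
apply/cyc_classP/cyc_classP=> -[e ei].
  by move->; exists (a + e)%N; [apply: eqmodD | rewrite exprD].
(* The term [a * #|F|.-1 - a] is a natural number playing the role of [-a]. *)
move=> xe; exists (a * #|F|.-1 - a + e)%N.
  apply/eqP; rewrite -(eqn_modDl a) addnA subnKC ?leq_pmulr //; apply/eqP.
  have /eqP aq : (N %| a * #|F|.-1)%N by rewrite dvdn_mull.
  by rewrite -modnDml aq add0n ei.
rewrite exprD -xe mulrA -exprD subnK ?leq_pmulr // mulnC exprM.
by rewrite (prim_expr_order gamma_prim) expr1n mul1r.
Qed.

Lemma expf_pf (x : F) : x ^+ (p ^ f) = x.
Proof. by rewrite -cardF expf_card. Qed.

(** Since [x ^+ (p ^ f) = x], Frobenius permutes the terms of the trace cyclically. *)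
Lemma psi_frobenius (x : F) : psi p f (x ^+ p) = psi p f x.
Proof.
congr (_ ^+ prime_field_rep _ _); rewrite /abs_trace.
case: (f) f_gt0 expf_pf => // f' _ xpf.
rewrite big_ord_recr big_ord_recl /= addrC -exprM -expnS xpf expr1.
by congr (_ + _); apply: eq_bigr => i _; rewrite -exprM -expnS.
Qed.

(** Frobenius is a bijection of [F] taking class [i] onto class [p * i] and preserving [psi]; its
    inverse is the power [p ^ f.-1]. *)
Lemma period_mul i : period (p * i) = period i.
Proof.
have frob_inj : injective (fun x : F => x ^+ p).
  move=> x y /(congr1 (fun z => z ^+ (p ^ f.-1))) /=.
  by rewrite -!exprM -expnS prednK // !expf_pf.
have pf1 : (p ^ f = 1 %[mod N])%N.
  apply/eqP; rewrite -cardF eqn_mod_dvd ?subn1 //.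
  exact: leq_trans q1_gt0 (leq_pred _).
rewrite /period (reindex_inj frob_inj) /=.
apply: eq_big => [x|x _]; last exact: psi_frobenius.
apply/cyc_classP/cyc_classP=> -[e ei].
  move=> xe; exists (e * p ^ f.-1)%N.
    rewrite (eqmodM ei (erefl _)) mulnAC -expnS prednK //.
    by rewrite (eqmodM pf1 (erefl _)) mul1n.
  by rewrite exprM -xe -exprM -expnS prednK // expf_pf.
by move->; exists (p * e)%N; [apply: eqmodM | rewrite mulnC exprM].
Qed.

End CyclotomicPeriods.

(** * Decomposition of the shifted character sum, and the bound *)

Lemma psi_shift_Dset (F : finFieldType) (gamma : F) (p1 p2 m n p f a : nat) :
  (#|F|.-1).-primitive_root gamma -> (p1 ^ m * p2 ^ n %| #|F|.-1)%N ->
  coprime p1 p2 -> (0 < p1)%N -> (0 < p2)%N ->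
  psi_shift p f gamma (Dset gamma p1 p2 m n) a
    = \sum_(i < p1 ^ m.-1) \sum_(j < p2 ^ n.-1)
        period gamma (p1 ^ m * p2 ^ n) p f (a + (p2 ^ n * i + p1 ^ m * j)).
Proof.
move=> gamma_prim N_dvd co12 p1_gt0 p2_gt0.
have coPQ : coprime (p1 ^ m) (p2 ^ n) by rewrite coprimeXl // coprimeXr.
have P_gt0 : (0 < p1 ^ m)%N by rewrite expn_gt0 p1_gt0.
have Q_gt0 : (0 < p2 ^ n)%N by rewrite expn_gt0 p2_gt0.
set P := (p1 ^ m)%N in coPQ N_dvd P_gt0 *.
set Q := (p2 ^ n)%N in coPQ N_dvd Q_gt0 *.
have P'_le : (p1 ^ m.-1 <= P)%N by rewrite leq_pexp2l ?leq_pred.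
have Q'_le : (p2 ^ n.-1 <= Q)%N by rewrite leq_pexp2l ?leq_pred.
have modP i j : (Q * i + P * j = Q * i %[mod P])%N.
  by rewrite addnC mulnC modnMDl.
have modQ i j : (Q * i + P * j = P * j %[mod Q])%N by rewrite mulnC modnMDl.
pose C i j := cyc_class gamma (P * Q) ((Q * i + P * j) %% (P * Q)).
(* By the Chinese remainder theorem the class determines [Q * i] modulo [P] and [P * j] modulo [Q],
   hence [i] and [j]; so the union is disjoint. *)
have C_inj (i i' : 'I_(p1 ^ m.-1)) (j j' : 'I_(p2 ^ n.-1)) x :
  x \in C i j -> x \in C i' j' -> i = i' /\ j = j'.
  move=> xC xC'; case: (boolP (Q * i + P * j == Q * i' + P * j' %[mod P * Q])%N).
    rewrite chinese_remainder // => /andP[/eqP + /eqP].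
    rewrite !modP !modQ => iP jQ.
    have co_QP : coprime Q P by rewrite coprime_sym.
    move: (eqmod_cancel P_gt0 co_QP iP) (eqmod_cancel Q_gt0 coPQ jQ).
    by rewrite !modn_small ?(leq_trans (ltn_ord _)) // => /val_inj-> /val_inj->.
  move/eqP=> ij; have dis : [disjoint C i j & C i' j'].
    by apply: (disjoint_cyc_class gamma_prim N_dvd); rewrite !modn_mod.
  by have := disjointFr dis xC; rewrite xC'.
rewrite /psi_shift partition_disjoint_bigcup => [|i i' ii']; last first.
  apply/pred0P => x /=; apply/andP=> -[/bigcupP[j _ xj] /bigcupP[j' _ xj']].
  by have [ii'_eq _] := C_inj _ _ _ _ _ xj xj'; rewrite ii'_eq eqxx in ii'.
apply: eq_bigr => i _.
rewrite partition_disjoint_bigcup => [|j j' jj']; last first.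
  apply/pred0P => x /=; apply/andP=> -[xj xj'].
  by have [_ jj'_eq] := C_inj _ _ _ _ _ xj xj'; rewrite jj'_eq eqxx in jj'.
apply: eq_bigr => j _; rewrite (sum_cyc_class_shift _ _ gamma_prim N_dvd).
by apply: (eq_period _ _ gamma_prim N_dvd); rewrite modnDmr.
Qed.

(** With [k], [l] the totients, [p ^ lcmn k l] is 1 modulo [M * M'], so the order [k * l / 2] is at
    most [lcmn k l]; hence the gcd is at most 2, and it is even. *)
Lemma ordmod_gcd_totient M M' p :
  coprime M M' -> (0 < M)%N -> (0 < M')%N ->
  ~~ odd (totient M) -> ~~ odd (totient M') ->
  is_ordmod M p (totient M) -> is_ordmod M' p (totient M') ->
  is_ordmod (M * M') p (totient (M * M') %/ 2) ->
  gcdn (totient M) (totient M') = 2.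
Proof.
move=> co M_gt0 M'_gt0 ev ev' [k_gt0 pk _] [l_gt0 pl _] [_ _ fmin].
set k := totient M in k_gt0 pk ev *; set l := totient M' in l_gt0 pl ev' *.
have two_dvd : (2 %| gcdn k l)%N by rewrite dvdn_gcd !dvdn2 ev ev'.
have L_gt0 : (0 < lcmn k l)%N by rewrite lcmn_gt0 k_gt0.
have /fmin : (p ^ lcmn k l = 1 %[mod M * M'])%N.
  apply/eqP; rewrite chinese_remainder //; apply/andP; split; apply/eqP.
    by have /dvdnP[d ->] := dvdn_lcml k l; rewrite expn_mod1.
  by have /dvdnP[d ->] := dvdn_lcmr k l; rewrite expn_mod1.
rewrite totient_coprime // -muln_lcm_gcd -muln_divA // => /(_ L_gt0).
rewrite -[X in (_ <= X)%N]muln1 leq_pmul2l // => g2.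
have g_gt0 : (0 < gcdn k l)%N by rewrite gcdn_gt0 k_gt0.
case/dvdnP: two_dvd g2 g_gt0 => g ->; rewrite mulnK //.
by case: g => [|[|]].
Qed.

Theorem theorem3p2 (p1 p2 m n p f : nat) (F : finFieldType) (gamma : F) :
  prime p1 -> (p1 %% 4 = 1)%N -> prime p2 -> (p2 %% 4 = 3)%N ->
  (0 < m)%N -> (0 < n)%N -> prime p ->
  is_ordmod (p1 ^ m) p (totient (p1 ^ m)) ->
  is_ordmod (p2 ^ n) p (totient (p2 ^ n)) ->
  is_ordmod (p1 ^ m * p2 ^ n) p f ->
  f = (totient (p1 ^ m * p2 ^ n) %/ 2)%N ->
  p \in [pchar F] -> #|F| = (p ^ f)%N ->
  (#|F|.-1).-primitive_root gamma ->
  (size (undup [seq psi_shift p f gamma (Dset gamma p1 p2 m n) a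
                 | a <- iota 0 (#|F|.-1)]) <= 5)%N.
Proof.
move=> p1_pr p1_4 p2_pr p2_4 m_gt0 n_gt0 _ p_ord1 p_ord2 p_ord.
move=> f_def _ cardF gamma_prim.
have p1_odd : odd p1 by rewrite -(odd_mod p1 (erefl : odd 4 = false)) p1_4.
have p2_odd : odd p2 by rewrite -(odd_mod p2 (erefl : odd 4 = false)) p2_4.
have co12 : coprime p1 p2.
  rewrite prime_coprime // dvdn_prime2 //; apply/eqP => p12.
  by move: p1_4; rewrite p12 p2_4.
have coPQ : coprime (p1 ^ m) (p2 ^ n) by rewrite coprime_pexpl // coprime_pexpr.
have co_QP' : coprime (p2 ^ n) (p1 ^ m.-1).
  by rewrite coprimeXl // coprimeXr // coprime_sym.
have co_PQ' : coprime (p1 ^ m) (p2 ^ n.-1) by rewrite coprimeXl // coprimeXr.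
have gcd2 : gcdn (totient (p1 ^ m)) (totient (p2 ^ n)) = 2.
  apply: (ordmod_gcd_totient coPQ _ _ _ _ p_ord1 p_ord2).
  - by rewrite expn_gt0 prime_gt0.
  - by rewrite expn_gt0 prime_gt0.
  - exact: totient_even.
  - exact: totient_even.
  - by rewrite -f_def.
have P_gt0 : (0 < p1 ^ m)%N by rewrite expn_gt0 prime_gt0.
have Q_gt0 : (0 < p2 ^ n)%N by rewrite expn_gt0 prime_gt0.
set P := (p1 ^ m)%N in p_ord1 p_ord coPQ co_QP' co_PQ' gcd2 P_gt0 *.
set Q := (p2 ^ n)%N in p_ord2 p_ord coPQ co_QP' co_PQ' gcd2 Q_gt0 *.
have N_dvd : (P * Q %| #|F|.-1)%N.
  have [_ pf _] := p_ord; rewrite cardF -subn1 -eqn_mod_dvd; first exact/eqP.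
  by rewrite -cardF; apply/card_gt0P; exists 0.
pose G x y := period gamma (P * Q) p f (chinese P Q x y).
have G_mod : bimodular P Q G.
  move=> x x' y y' xx' yy'; apply: (eq_period _ _ gamma_prim N_dvd).
  apply/eqP; rewrite chinese_remainder //.
  by rewrite !chinese_modl // !chinese_modr // xx' yy' !eqxx.
have G_mul : mul_invariant p G.
  move=> x y; rewrite /G -[RHS](period_mul gamma_prim N_dvd cardF).
  apply: (eq_period _ _ gamma_prim N_dvd); apply/eqP; rewrite chinese_remainder //.
  apply/andP; split; apply/eqP.
    by rewrite chinese_modl // -[RHS]modnMmr chinese_modl // modnMmr.
  by rewrite chinese_modr // -[RHS]modnMmr chinese_modr // modnMmr.
(* The index [a + (Q * i + P * j)] has Chinese coordinates [a + Q * i] and [a + P * j], so the shift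
   [a] is the origin of both progressions. *)
have psi_shiftE a : psi_shift p f gamma (Dset gamma p1 p2 m n) a
    = \sum_(i < p1 ^ m.-1) \sum_(j < p2 ^ n.-1) G (a + Q * i)%N (a + P * j)%N.
  rewrite psi_shift_Dset ?prime_gt0 //; apply: eq_bigr => i _; apply: eq_bigr => j _.
  apply: (eq_period _ _ gamma_prim N_dvd); apply/eqP.
  rewrite chinese_remainder // chinese_modl // chinese_modr // !addnA.
  apply/andP; split; apply/eqP; first by rewrite addnC mulnC modnMDl.
  by rewrite addnAC addnC mulnC modnMDl.
pose T := box_sum (p1 ^ m.-1) (p2 ^ n.-1) G.
pose s := [:: T 0 0; T (p1 ^ m.-1) 0; T 0 (p2 ^ n.-1);
              T (p1 ^ m.-1) (p2 ^ n.-1); T (p1 ^ m.-1) (p * p2 ^ n.-1)]%N.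
apply: (@leq_trans (size s)) => //; apply: uniq_leq_size; first exact: undup_uniq.
move=> v; rewrite mem_undup => /mapP[a _ ->]; rewrite psi_shiftE.
have [x [y [x_dvd y_dvd ->]]] := sum_box p1_pr p1_odd m_gt0 p2_pr p2_odd n_gt0
  p_ord1 p_ord2 gcd2 G_mod G_mul a a co_QP' co_PQ'.
apply: (five_orbits p1_pr m_gt0 p2_pr n_gt0 p_ord1 p_ord2 gcd2) => //.
  exact: box_sum_mod.
exact: box_sum_mul.
Qed.
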